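(* Let $\Pi(\Delta)=\{\Delta_1,\dots,\Delta_s\}$ be a generalized nef partition of $\Delta$. For $j=1,\dots,s$ let $\nabla_j:=\{n\in N_{\mathbb R}:\langle m,n\rangle\ge-\delta_{i,j}\ \forall m\in\Delta_i,\ i=1,\dots,s\}$ and $\nabla:=\nabla_1+\dots+\nabla_s$. Then $\Pi(\nabla)=\{\nabla_1,\dots,\nabla_s\}$ is a generalized nef partition of $\nabla$, and for $i=1,\dots,s$ we have $$\Delta_i=\{m\in M_{\mathbb R}:\langle m,n\rangle\ge-\delta_{i,j}\text{ for all }n\in\nabla_j,\ j=1,\dots,s\}.$$
   Context: $N\cong\mathbb Z^n$ is a lattice, $M=\mathrm{Hom}(N,\mathbb Z)$, with rational and real extensions and pairing $\langle\cdot,\cdot\rangle$. $\Delta\subset M_{\mathbb Q}$ is a polytope containing the origin in its interior; its polar is $\Delta^\circ=\{n:\langle m,n\rangle\ge-1\ \forall m\in\Delta\}$. Given a partition $\mathrm{Vert}(\Delta^\circ)=I_1\sqcup\dots\sqcup I_s$ into non-empty sets, $\Delta_i=\{m:\langle m,n_\rho\rangle\ge-\mathbf 1_i(n_\rho)\ \forall n_\rho\in\mathrm{Vert}(\Delta^\circ)\}$, where $\mathbf 1_i(n_\rho)=1$ if $n_\rho\in I_i$ and $0$ otherwise. A set $\Pi(\Delta)=\{\Delta_1,\dots,\Delta_s\}$ obtained in this way from some partition is a generalized nef partition of $\Delta$ if $\Delta=\Delta_1+\dots+\Delta_s$ (Minkowski sum). The same definition, with the roles of $M$ and $N$ exchanged,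 applies to polytopes $\nabla\subset N_{\mathbb Q}$ with polar $\nabla^\circ\subset M_{\mathbb Q}$ (so the parts come from a partition of $\mathrm{Vert}(\nabla^\circ)$). *)

(* Defs.v *)
From HB Require Import structures.
From mathcomp Require Import all_boot all_order all_algebra.
From mathcomp Require Import all_classical all_reals topology normedtype numfun.

Set Implicit Arguments.
Unset Strict Implicit.
Unset Printing Implicit Defensive.

Import Order.TTheory GRing.Theory Num.Theory.
Import numFieldNormedType.Exports.

Local Open Scope classical_set_scope.
Local Open Scope ring_scope.

(* A basis of N and the dual basis of M identify both N_R and M_R with the row
   vectors 'rV[R]_n, N_Q and M_Q with the vectors having rational coordinates,
   and the duality pairing with the standard bilinear form.  As this form is
   symmetric, every definition below serves for M and for N: exchanging the
   roles of M and N leaves it unchanged. *)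
Definition pairing (R : realType) (n : nat) (x y : 'rV[R]_n) : R :=
  \sum_(k < n) x ord0 k * y ord0 k.

Definition conv_hull (R : realType) (n k : nat) (v : 'I_k -> 'rV[R]_n) :
    set 'rV[R]_n :=
  [set x | exists a : 'I_k -> R,
     [/\ forall i, 0 <= a i, \sum_i a i = 1 & x = \sum_i a i *: v i]].

(* A polytope in M_Q (or N_Q), given by its set of real points. *)
Definition rational_polytope (R : realType) (n : nat) (P : set 'rV[R]_n) : Prop :=
  exists (k : nat) (v : 'I_k -> 'rV[rat]_n),
    P = conv_hull (fun i => map_mx (@ratr R) (v i)).

Definition polar (R : realType) (n : nat) (P : set 'rV[R]_n) : set 'rV[R]_n :=
  [set y | forall x, P x -> -1 <= pairing x y].

(* The vertices are the zero-dimensional faces, a face being the locus where a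
   linear form attains its minimum on P. *)
Definition vertices (R : realType) (n : nat) (P : set 'rV[R]_n) : set 'rV[R]_n :=
  [set v | P v /\ exists u : 'rV[R]_n,
     forall w, P w -> w <> v -> pairing u v < pairing u w].

Definition minkowski_sum (R : realType) (n s : nat)
    (D : 'I_s -> set 'rV[R]_n) : set 'rV[R]_n :=
  [set x | exists f : 'I_s -> 'rV[R]_n,
     (forall i, D i (f i)) /\ x = \sum_i f i].

Definition partition_part (R : realType) (n s : nat) (P : set 'rV[R]_n)
    (I : 'I_s -> set 'rV[R]_n) (i : 'I_s) : set 'rV[R]_n :=
  [set x | forall y, vertices (polar P) y -> - \1_(I i) y <= pairing x y].

(* [partition setT I A] includes that every [I i] is non-empty.  The parts are
   labelled as in the partition they come from. *)
Definition generalized_nef_partition (R : realType) (n s : nat)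
    (P : set 'rV[R]_n) (D : 'I_s -> set 'rV[R]_n) : Prop :=
  [/\ rational_polytope P,
      interior P 0,
      exists I : 'I_s -> set 'rV[R]_n,
        partition setT I (vertices (polar P)) /\
        (forall i, D i = partition_part P I i)
    & P = minkowski_sum D].

Definition dual_part (R : realType) (n s : nat) (D : 'I_s -> set 'rV[R]_n)
    (j : 'I_s) : set 'rV[R]_n :=
  [set y | forall (i : 'I_s) x, D i x -> - (i == j)%:R <= pairing x y].

(* Main.v *)
Require Import Defs.
From HB Require Import structures.
From mathcomp Require Import all_boot all_order all_algebra.
From mathcomp Require Import all_classical all_reals topology normedtype numfun.
From mathcomp Require Import lra.

(** Write [V] for the vertices of the polar of [Delta], split by the partition
    into parts [I_i], and [nabla] for the Minkowski sum of the dual parts.  Two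
    facts carry the proof.

    The first, [labelling_decomposition], is where [Delta] being the sum of the
    [D i] enters.  Given a vector [y], let [x0] minimise [<., y>] on [Delta].
    Then [y] lies in the cone over those [v] in [V] with [<x0, v> = -1]
    (otherwise a Farkas functional would move [x0] inside [Delta] and decrease
    the minimum), so [y = sum_v a_v v] with [v] in that set.  Decompose [x0] as
    a sum of [x_i] in [D i].  For such [v] the lower bounds [<x_i, v> >= -1] if
    [v] is in [I_i] and [>= 0] otherwise add up to [-1 = <x0, v>], hence are
    equalities, so that [<x_i, y> = - A_i] with [A_i] the sum of the [a_v] over
    [I_i].  Any lower bound for [<., y>] on the [D i] thus bounds the [A_i].
    It follows that the dual part of index [j] is the convex hull of [0] and
    [I_j], and that [nabla] consists of all [y] with [<x, y> >= -1] on every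
    [D i] ([dual_part_decomposition], [dual_sum_mem]); in particular [nabla] is
    a rational polytope with [0] in its interior.

    The second, [dual_vertex_mem], is that each vertex [w] of the polar of
    [nabla] lies in some [D i].  Decompose the form [u] that exposes [w], take
    [i] with [A_i] maximal and [x_i] in [D i] with [<x_i, u> = - A_i].  For
    every positive [c >= A_i] the vector [u / c] lies in [nabla], so [w] cannot
    do better than [- A_i] on [u], and [w = x_i].  The vertices of the polar of
    [nabla] are therefore covered by the [D i].  No vertex lies in two of them
    unless the whole space is zero ([dual_vertex_meet]), and each [D i] contains
    one: if [v] is in [I_i], the form [<., v>] takes the value [-1] on [D i],
    hence a value at most [-1] at some vertex, and it is nonnegative on the
    other parts.  This partition satisfies the hypotheses of the first fact with [dual_part D] in place of [D]: decomposing
    the elements of the [D i] along these vertices shows that the dual parts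
    are cut out by them.

    The polyhedral input, that the polar of a rational polytope around [0] has
    finitely many, rational vertices and that they recover the polytope, is
    [rational_polytope_vertices]; it is proved from Farkas' lemma by moving
    points along the common kernel of the constraints active at them. *)

Set Implicit Arguments.
Unset Strict Implicit.
Unset Printing Implicit Defensive.

Import Order.TTheory GRing.Theory Num.Theory.
Import numFieldNormedType.Exports.

Local Open Scope classical_set_scope.
Local Open Scope ring_scope.

(** * The pairing *)

Lemma pairingC (R : realType) (n : nat) (x y : 'rV[R]_n) :
  pairing x y = pairing y x.
Proof. by apply: eq_bigr => k _; rewrite mulrC. Qed.

Lemma pairingDr (R : realType) (n : nat) (u x y : 'rV[R]_n) :
  pairing u (x + y) = pairing u x + pairing u y.
Proof. by rewrite -big_split; apply: eq_bigr => k _; rewrite mxE mulrDr. Qed.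

Lemma pairingZr (R : realType) (n : nat) (u x : 'rV[R]_n) (c : R) :
  pairing u (c *: x) = c * pairing u x.
Proof. by rewrite mulr_sumr; apply: eq_bigr => k _; rewrite mxE mulrCA. Qed.

Lemma pairing0r (R : realType) (n : nat) (u : 'rV[R]_n) : pairing u 0 = 0.
Proof. by rewrite -(scale0r 0) pairingZr mul0r. Qed.

Lemma pairingNr (R : realType) (n : nat) (u x : 'rV[R]_n) :
  pairing u (- x) = - pairing u x.
Proof. by rewrite -scaleN1r pairingZr mulN1r. Qed.

Lemma pairing_sumr (R : realType) (n : nat) (T : finType) (P : pred T)
    (u : 'rV[R]_n) (F : T -> 'rV[R]_n) :
  pairing u (\sum_(i | P i) F i) = \sum_(i | P i) pairing u (F i).
Proof. exact: (big_morph _ (pairingDr u) (pairing0r u)). Qed.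

Lemma pairingDl (R : realType) (n : nat) (u x y : 'rV[R]_n) :
  pairing (x + y) u = pairing x u + pairing y u.
Proof. by rewrite !(pairingC _ u) pairingDr. Qed.

Lemma pairingZl (R : realType) (n : nat) (u x : 'rV[R]_n) (c : R) :
  pairing (c *: x) u = c * pairing x u.
Proof. by rewrite !(pairingC _ u) pairingZr. Qed.

Lemma pairing0l (R : realType) (n : nat) (u : 'rV[R]_n) : pairing 0 u = 0.
Proof. by rewrite pairingC pairing0r. Qed.

Lemma pairingNl (R : realType) (n : nat) (u x : 'rV[R]_n) :
  pairing (- x) u = - pairing x u.
Proof. by rewrite !(pairingC _ u) pairingNr. Qed.

Lemma pairing_suml (R : realType) (n : nat) (T : finType) (P : pred T)
    (u : 'rV[R]_n) (F : T -> 'rV[R]_n) :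
  pairing (\sum_(i | P i) F i) u = \sum_(i | P i) pairing (F i) u.
Proof.
by rewrite pairingC pairing_sumr; apply: eq_bigr => i _; rewrite pairingC.
Qed.

Lemma pairing_gt0 (R : realType) (n : nat) (x : 'rV[R]_n) :
  x != 0 -> 0 < pairing x x.
Proof.
move=> x0; rewrite lt_neqAle sumr_ge0 ?andbT; last first.
  by move=> k _; rewrite -expr2 sqr_ge0.
apply: contra x0 => /eqP/esym/psumr_eq0P x0; apply/eqP/rowP => k; rewrite mxE.
apply/eqP; rewrite -sqrf_eq0 expr2 x0 // => j _.
by rewrite -expr2 sqr_ge0.
Qed.

Lemma pairing_row_mx (R : realType) (n m : nat) (x y : 'rV[R]_n)
    (a b : 'rV[R]_m) :
  pairing (row_mx x a) (row_mx y b) = pairing x y + pairing a b.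
Proof.
rewrite /pairing big_split_ord /=.
by congr (_ + _); apply: eq_bigr => k _; rewrite ?row_mxEl ?row_mxEr.
Qed.

(** * Farkas' lemma and convex hulls *)

(** A slack that is positive survives a short enough move: this is what lets
    one perturb a point while only watching the constraints active at it. *)
Lemma small_step (R : realType) (k : nat) (b d : 'I_k -> R) :
  exists2 e : R, 0 < e & forall l, 0 < b l -> e * `|d l| <= b l.
Proof.
pose S := 1 + \sum_(l | 0 < b l) `|d l| / b l.
have S0 : 0 < S.
  by rewrite ltr_pwDl// sumr_ge0// => l bl; rewrite divr_ge0// ltW.
exists S^-1; first by rewrite invr_gt0.
move=> l bl; rewrite mulrC ler_pdivrMr// mulrC -ler_pdivrMr//.
rewrite /S (bigD1 l)//= addrCA lerDl addr_ge0// sumr_ge0// => i /andP[bi _].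
by rewrite divr_ge0// ltW.
Qed.

(** Bartl's argument, by induction on the number of generators.  If a functional
    [u] separates [y] from all generators but the first, [v0], and fails on
    [v0], project along [v0] onto the kernel of [u] and use the induction
    hypothesis there. *)
Lemma farkas (R : realType) (n k : nat) (v : 'I_k -> 'rV[R]_n) (y : 'rV[R]_n) :
  (exists2 a : 'I_k -> R, (forall l, 0 <= a l) & y = \sum_l a l *: v l) \/
  (exists2 u, (forall l, 0 <= pairing u (v l)) & pairing u y < 0).
Proof.
elim: k v y => [|k IH] v y.
  have [->|y0] := eqVneq y 0; first by left; exists (fun=> 0); rewrite ?big_ord0.
  by right; exists (- y) => [[]//|]; rewrite pairingNl oppr_lt0 pairing_gt0.
pose v0 := v ord0; pose v1 l := v (lift ord0 l).
have [[a a0 ya]|[u uv uy]] := IH v1 y.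
  left; exists (fun l => if unlift ord0 l is Some i then a i else 0).
    by move=> l; case: unliftP.
  rewrite big_ord_recl unlift_none scale0r add0r ya.
  by apply: eq_bigr => l _; rewrite liftK.
have [uv0|uv0] := leP 0 (pairing u v0).
  right; exists u => // l; case: (unliftP ord0 l) => [i ->|->//]; exact: uv.
set al := pairing u v0 in uv0.
have al0 : al != 0 by rewrite lt_eqF.
pose pr x := x - (pairing u x / al) *: v0.
have [[b b0 yb]|[u' uv' uy']] := IH (fun l => pr (v1 l)) (pr y).
  (* Undoing the projection puts the coefficient [c] on [v0]; it is a quotient of
     two negative numbers. *)
  left; pose c := (pairing u y - \sum_l b l * pairing u (v1 l)) / al.
  exists (fun l => if unlift ord0 l is Some i then b i else c).
    move=> l; case: unliftP => // _.
    rewrite /c -mulrNN mulr_ge0// ?oppr_ge0 ?invr_le0 ?(ltW uv0)//.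
    rewrite subr_le0 (le_trans (ltW uy))// sumr_ge0// => i _.
    by rewrite mulr_ge0// uv.
  rewrite big_ord_recl unlift_none -/v0.
  under eq_bigr => i _ do rewrite liftK.
  have sumE : \sum_l b l *: pr (v1 l) =
      \sum_l b l *: v1 l - ((\sum_l b l * pairing u (v1 l)) / al) *: v0.
    rewrite mulr_suml scaler_suml -sumrB; apply: eq_bigr => l _.
    by rewrite /pr scalerBr scalerA mulrA.
  move/eqP: yb; rewrite sumE subr_eq => /eqP {1}->.
  by rewrite /c mulrBl scalerBl [RHS]addrC addrAC addrA.
right; exists (u' - (pairing u' v0 / al) *: u) => [l|].
  rewrite pairingDl pairingNl pairingZl.
  case: (unliftP ord0 l) => [i ->|->]; last by rewrite -/al divfK// subrr.
  have := uv' i; rewrite /pr pairingDr pairingNr pairingZr -/(v1 i).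
  by rewrite (mulrAC _ _ (pairing u _)) (mulrAC (pairing u _)) (mulrC (pairing u _)).
move: uy'; rewrite /pr pairingDr pairingNr pairingZr pairingDl pairingNl pairingZl.
by rewrite (mulrAC _ _ (pairing u _)) (mulrAC (pairing u _)) (mulrC (pairing u _)).
Qed.

(** Farkas' lemma for the homogenised vectors [(v l, 1)].  A functional [(u, c)]
    separating [(x, 1)] from them says that [u] is at least [- c] on the
    generators and less than [- c] at [x]. *)
Lemma conv_hull_support (R : realType) (n k : nat) (v : 'I_k -> 'rV[R]_n)
    (x : 'rV[R]_n) :
  conv_hull v x <-> forall u, exists l, pairing u (v l) <= pairing u x.
Proof.
split=> [[a [a0 a1 ->]] u|H].
  apply/existsP; rewrite -[X in is_true X]negbK negb_exists.
  apply/negP => /forallP gtx; pose c := pairing u (\sum_i a i *: v i).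
  have : \sum_l a l * (pairing u (v l) - c) = 0.
    under eq_bigr => l _ do rewrite mulrBr.
    rewrite sumrB -mulr_suml a1 mul1r /c pairing_sumr.
    by under [X in _ - X]eq_bigr => l _ do rewrite pairingZr; rewrite subrr.
  have gtc l : 0 < pairing u (v l) - c by rewrite subr_gt0 ltNge gtx.
  move/psumr_eq0P => a00; have := a1; rewrite big1 => [/eqP|l _].
    by rewrite eq_sym oner_eq0.
  apply/eqP; have /eqP := a00 (fun l _ => mulr_ge0 (a0 l) (ltW (gtc l))) l isT.
  by rewrite mulf_eq0 (gt_eqF (gtc l)) orbF.
have [[a a0 E]|[u]] :=
    farkas (fun l => row_mx (v l) (const_mx 1 : 'rV_1)) (row_mx x (const_mx 1)).
  exists a; split => //.
    have := congr1 (fun M : 'rV[R]_(n + 1) => M ord0 (rshift n ord0)) E.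
    rewrite summxE row_mxEr mxE => ->.
    by apply: eq_bigr => l _; rewrite mxE row_mxEr !mxE mulr1.
  apply/rowP => i; have := congr1 (fun M : 'rV[R]_(n + 1) => M ord0 (lshift 1 i)) E.
  rewrite !summxE row_mxEl => ->.
  by apply: eq_bigr => l _; rewrite mxE row_mxEl mxE.
rewrite -[u]hsubmxK => uv; rewrite !pairing_row_mx => ux.
have [l lx] := H (lsubmx u); have := uv l; rewrite !pairing_row_mx.
by move=> uvl; have := le_lt_trans uvl (le_lt_trans (lerD lx (lexx _)) ux);
  rewrite ltxx.
Qed.

(** * Vertices of the polar of a polytope *)

Lemma interior_absorbing (R : realType) (n : nat) (P : set 'rV[R]_n) :
  interior P 0 -> forall u, exists2 e : R, 0 < e & P (e *: u).
Proof.
move=> /nbhs_ballP[e /= e0 eP] u.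
have [t t0 tu] := small_step (fun=> e / 2) (fun k => u ord0 k).
exists t => //; apply: eP; split=> // i j; rewrite /ball /= !mxE sub0r normrN ord1.
rewrite normrM gtr0_norm// (le_lt_trans (tu j _))//; first by rewrite divr_gt0.
by rewrite ltr_pdivrMr// mulr_natr mulr2n ltrDl.
Qed.

Lemma polar_conv_hull (R : realType) (n k : nat) (w : 'I_k -> 'rV[R]_n)
    (y : 'rV[R]_n) :
  polar (conv_hull w) y <-> forall l, -1 <= pairing (w l) y.
Proof.
split=> [H l|H x /conv_hull_support/(_ y)[l]]; last first.
  by rewrite !(pairingC y); apply: le_trans.
by apply/H/conv_hull_support => u; exists l.
Qed.

Lemma interior_polar_conv_hull (R : realType) (n k : nat)
    (w : 'I_k -> 'rV[R]_n) : interior (polar (conv_hull w)) 0.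
Proof.
pose S := 1 + \sum_l \sum_(j < n) `|w l ord0 j|.
have S_ge0 l : 0 <= \sum_(j < n) `|w l ord0 j| by rewrite sumr_ge0.
have S0 : 0 < S by rewrite ltr_pwDl// sumr_ge0.
apply/nbhs_ballP; exists S^-1; first by rewrite /= invr_gt0.
move=> y [_ By]; apply/polar_conv_hull => l.
rewrite -[pairing _ _]opprK lerN2 -pairingNr (le_trans (ler_norm _))//.
apply: (@le_trans _ _ (\sum_(j < n) `|w l ord0 j| * S^-1)).
  apply: (le_trans (ler_norm_sum _ _ _)); apply: ler_sum => j _.
  rewrite normrM ler_wpM2l// mxE normrN; have := By ord0 j.
  by rewrite /ball /= mxE sub0r normrN => /ltW.
rewrite -mulr_suml ler_pdivrMr// mul1r /S (bigD1 l)//= addrCA lerDl.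
by rewrite addr_ge0// sumr_ge0.
Qed.

(** If [d] is orthogonal to the constraints active at a vertex [y], both [y + e d]
    and [y - e d] are feasible for small [e], and the form exposing [y] cannot
    increase in both directions. *)
Lemma vertex_rigid (R : realType) (n k : nat) (w : 'I_k -> 'rV[R]_n)
    (y d : 'rV[R]_n) :
  vertices (polar (conv_hull w)) y ->
  (forall l, pairing (w l) y = -1 -> pairing (w l) d = 0) -> d = 0.
Proof.
move=> [/polar_conv_hull Qy [u uy]] dact; apply/eqP; apply: contraT => d0.
have [e e0 He] :=
  small_step (fun l => pairing (w l) y + 1) (fun l => pairing (w l) d).
have Q c : `|c| = e -> pairing u y < pairing u (y + c *: d).
  move=> ce; apply: uy; last first.
    move=> /(canRL (addKr y)) /eqP; rewrite addNr scaler_eq0 (negbTE d0) orbF.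
    by rewrite -normr_eq0 ce gt_eqF.
  apply/polar_conv_hull => l; rewrite pairingDr pairingZr.
  have := Qy l; rewrite le_eqVlt => /orP[/eqP/esym yl|yl].
    by rewrite yl dact// mulr0 addr0.
  rewrite -subr_ge0 opprK addrAC -lerBlDr sub0r.
  apply: le_trans (He l _); last by rewrite -(opprK 1) subr_gt0.
  by rewrite -ce -normrM -normrN ler_norm.
have := Q e (gtr0_norm e0); have := Q (- e); rewrite normrN gtr0_norm// => /(_ erefl).
rewrite !pairingDr !ltrDl !pairingZr mulNr oppr_gt0 => lt0 gt0.
by have := lt_trans lt0 gt0; rewrite ltxx.
Qed.

(** The sum of the constraints active at [y] exposes it. *)
Lemma rigid_vertex (R : realType) (n k : nat) (w : 'I_k -> 'rV[R]_n)
    (y : 'rV[R]_n) :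
  polar (conv_hull w) y ->
  (forall d, (forall l, pairing (w l) y = -1 -> pairing (w l) d = 0) -> d = 0) ->
  vertices (polar (conv_hull w)) y.
Proof.
move=> Qy rigid; split=> //; exists (\sum_(l | pairing (w l) y == -1) w l).
move=> z /polar_conv_hull Qz zy; rewrite !pairing_suml lt_neqAle.
have le_yz l : pairing (w l) y == -1 -> 0 <= pairing (w l) z - pairing (w l) y.
  by move/eqP ->; rewrite subr_ge0.
rewrite andbC -subr_ge0 -sumrB sumr_ge0 //=; apply: contra_notN zy.
rewrite eq_sym -subr_eq0 -sumrB => /eqP/(psumr_eq0P le_yz) eq0.
apply/eqP; rewrite -subr_eq0; apply/eqP/rigid => l /eqP yl.
by rewrite pairingDr pairingNr eq0.
Qed.

(** The number of inactive constraints decreases: from a point that is not a vertex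
    move in a direction orthogonal to the active constraints, with the sign
    that does not increase [<x, .>], until another constraint becomes active.
    That happens because the polytope [conv_hull w] absorbs [- d], so that some
    constraint decreases along [d]. *)
Lemma vertex_below (R : realType) (n k : nat) (w : 'I_k -> 'rV[R]_n)
    (x y : 'rV[R]_n) :
  (forall u, exists2 e : R, 0 < e & conv_hull w (e *: u)) ->
  polar (conv_hull w) y ->
  exists2 v, vertices (polar (conv_hull w)) v & pairing x v <= pairing x y.
Proof.
move=> abs.
have [m] := ubnP #|[pred l | pairing (w l) y != -1]|.
elim: m y => // m IH y; rewrite ltnS => ym Qy.
have [rigid|] := pselect (forall d,
    (forall l, pairing (w l) y = -1 -> pairing (w l) d = 0) -> d = 0).
  by exists y => //; apply: rigid_vertex.
move=> /existsNP[d0 /not_implyP[d0act /eqP d0n0]].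
have [d [dact dn0 dx]] : exists d,
    [/\ forall l, pairing (w l) y = -1 -> pairing (w l) d = 0, d != 0 &
        pairing x d <= 0].
  have [dx|dx] := leP (pairing x d0) 0; first by exists d0.
  exists (- d0); rewrite oppr_eq0 pairingNr oppr_le0 (ltW dx); split=> // l yl.
  by rewrite pairingNr d0act// oppr0.
have [l0 l0d] : exists l, pairing (w l) d < 0.
  have [e e0 /conv_hull_support/(_ d)[l ld]] := abs (- d).
  exists l; rewrite pairingC (le_lt_trans ld)// pairingZr pairingNr mulrN.
  by rewrite oppr_lt0 mulr_gt0// pairing_gt0.
(* [F l] is the time at which the constraint [l] becomes active. *)
pose F l := (pairing (w l) y + 1) / - pairing (w l) d.
case: (@arg_minP _ _ _ l0 (fun l => pairing (w l) d < 0) F) => // l1 l1d minF.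
have Qy1 := (iffLR (polar_conv_hull w y)) Qy.
have F0 : 0 <= F l1.
  by rewrite divr_ge0 ?oppr_ge0 ?(ltW l1d)// -(opprK 1) subr_ge0.
pose y' := y + F l1 *: d.
have Qy' : polar (conv_hull w) y'.
  apply/polar_conv_hull => l; rewrite pairingDr pairingZr.
  have [ld|ld] := leP 0 (pairing (w l) d).
    by rewrite (le_trans (Qy1 l))// lerDl mulr_ge0.
  rewrite -subr_ge0 opprK addrAC -lerBlDr sub0r -mulrN -ler_pdivlMr ?oppr_gt0//.
  exact: minF.
have lt_ym : (#|[pred l | (pairing (w l) y' != -1)%R]| < m)%N.
  apply: leq_trans ym; apply: proper_card; apply/properP; split.
    apply/fintype.subsetP => l; rewrite !inE; apply: contra => /eqP yl.
    by rewrite pairingDr pairingZr dact// mulr0 addr0 yl.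
  exists l1; rewrite !inE.
    by apply/negP => /eqP /dact ld0; rewrite ld0 ltxx in l1d.
  rewrite negbK pairingDr pairingZr -[X in F l1 * X]opprK mulrN.
  by rewrite divfK ?oppr_eq0 ?(lt_eqF l1d)// opprD addrA subrr sub0r.
have [v Vv vy'] := IH y' lt_ym Qy'.
exists v => //; rewrite (le_trans vy')// pairingDr pairingZr gerDl.
by rewrite mulr_ge0_le0.
Qed.

(** A point [x] outside the polytope is separated from it by some [u]; scaled so that
    its minimum on the polytope is [-1], [u] lies in the polar with [<x, u> < -1],
    and then some vertex of the polar also takes a value below [-1] at [x]. *)
Lemma bipolar_vertices (R : realType) (n k : nat) (w : 'I_k -> 'rV[R]_n) :
  (forall u, exists2 e : R, 0 < e & conv_hull w (e *: u)) ->
  polar (vertices (polar (conv_hull w))) = conv_hull w.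
Proof.
move=> abs; apply/seteqP; split=> [x Px|x wx v [Qv _]]; last first.
  by rewrite pairingC; apply: Qv.
apply/conv_hull_support => u; apply: contrapT => /forallNP ux.
have [l0 l0u] : exists l, pairing u (w l) <= 0.
  have [e e0 /conv_hull_support/(_ u)[l lu]] := abs (- u).
  exists l; rewrite (le_trans lu)// pairingZr pairingNr mulrN oppr_le0.
  have [->|u0] := eqVneq u 0; first by rewrite pairing0l mulr0.
  by rewrite mulr_ge0 ?ltW// pairing_gt0.
have un0 : u != 0.
  by apply/negP => /eqP u0; have := ux l0; rewrite u0 !pairing0l lexx.
case: (@arg_minP _ _ _ l0 xpredT (fun l => pairing u (w l))) => // l1 _ minl.
have l1u : pairing u (w l1) < 0.
  have [e e0 /conv_hull_support/(_ u)[l lu]] := abs (- u).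
  apply: (le_lt_trans (minl l isT)); rewrite (le_lt_trans lu)//.
  by rewrite pairingZr pairingNr mulrN oppr_lt0 mulr_gt0// pairing_gt0.
pose c := (- pairing u (w l1))^-1.
have c0 : 0 < c by rewrite invr_gt0 oppr_gt0.
have cl1 : c * pairing u (w l1) = -1.
  by rewrite -[pairing _ _]opprK mulrN mulVf// oppr_eq0 lt_eqF.
have [] := @vertex_below _ _ _ w x (c *: u) abs.
  apply/polar_conv_hull => l.
  by rewrite pairingZr pairingC -cl1 ler_pM2l// minl.
move=> v Vv; apply/negP; rewrite -ltNge.
apply: (@lt_le_trans _ _ (-1)); last by rewrite pairingC; apply: Px.
rewrite pairingZr -cl1 ltr_pM2l// pairingC ltNge; exact/negP/ux.
Qed.

(** By [vertex_rigid] a vertex is determined by its set of active constraints, which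
    gives finiteness, and it is the only solution of the rational linear system
    that they form; such a system, solvable over the reals, has a rational
    solution. *)
Lemma finite_rational_vertices (R : realType) (n k : nat)
    (w : 'I_k -> 'rV[rat]_n) :
  let P := conv_hull (fun l => map_mx (@ratr R) (w l)) in
  vertices (polar P) !=set0 ->
  exists (m : nat) (v : 'I_m -> 'rV[rat]_n),
    vertices (polar P) = range (fun l => map_mx (@ratr R) (v l)).
Proof.
move=> P [v0 Vv0].
pose wR l := map_mx (@ratr R) (w l).
pose active y := [set l | pairing (wR l) y == -1]%SET.
have solve y : vertices (polar P) y -> exists r, y = map_mx (@ratr R) r.
  move=> Vy.
  pose B : 'M[rat]_(n, k) :=
    \matrix_(i, l) (if l \in active y then w l ord0 i else 0).
  pose c : 'rV[rat]_k := \row_l (if l \in active y then -1 else 0).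
  have coefB z l : (z *m map_mx (@ratr R) B) ord0 l =
      if l \in active y then pairing (wR l) z else 0.
    rewrite mxE; case: ifP => ly; last first.
      by rewrite big1// => i _; rewrite !mxE ly rmorph0 mulr0.
    by apply: eq_bigr => i _; rewrite !mxE ly mulrC.
  (* Membership in a row space does not depend on the field. *)
  have : (c <= B)%MS.
    rewrite -(map_submx (@ratr R)); apply/submxP; exists y; apply/rowP => l.
    rewrite coefB !mxE; case: ifPn => [|_]; last by rewrite rmorph0.
    by rewrite inE => /eqP ->; rewrite rmorphN1.
  move=> /submxP[r cE]; exists r; apply/eqP; rewrite -subr_eq0; apply/eqP.
  apply: (vertex_rigid Vy) => l yl.
  have ly : l \in active y by rewrite inE yl.
  have := coefB (map_mx (@ratr R) r) l; rewrite -map_mxM -cE !mxE ly.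
  by rewrite rmorphN1 pairingDr pairingNr yl => <-; rewrite subrr.
(* Sets of constraints that are not the active set of a vertex are sent to the
   vertex [v0], so that the enumeration may have repetitions. *)
have pick (A : {set 'I_k}) : exists r, vertices (polar P) (map_mx (@ratr R) r) /\
    forall y, vertices (polar P) y -> active y = A -> y = map_mx (@ratr R) r.
  have [[y [Vy <-]]|none] := pselect (exists y, vertices (polar P) y /\ active y = A).
    have [r yr] := solve y Vy; exists r; rewrite -yr; split=> // z Vz zy.
    apply/eqP; rewrite -subr_eq0; apply/eqP; apply: (vertex_rigid Vz) => l zl.
    have : l \in active z by rewrite inE zl.
    by rewrite zy inE => /eqP yl; rewrite pairingDr pairingNr yl zl subrr.
  have [r v0r] := solve v0 Vv0; exists r; rewrite -v0r; split=> // y Vy yA.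
  by case: none; exists y.
have [r Hr] := choice pick.
exists #|{set 'I_k}|, (fun l => r (enum_val l)); apply/seteqP; split=> [y Vy|y].
  by exists (enum_rank (active y)) => //; rewrite enum_rankK; apply/esym/(Hr _).2.
by move=> [l _ <-]; apply: (Hr _).1.
Qed.

Lemma rational_polytope_vertices (R : realType) (n : nat) (P : set 'rV[R]_n) :
  rational_polytope P -> interior P 0 ->
  [/\ polar (vertices (polar P)) = P,
      forall x y, polar P y ->
        exists2 v, vertices (polar P) v & pairing x v <= pairing x y &
      exists (m : nat) (v : 'I_m -> 'rV[rat]_n),
        vertices (polar P) = range (fun l => map_mx (@ratr R) (v l))].
Proof.
move=> [k [w ->]] /interior_absorbing abs.
have below x y := @vertex_below _ _ _ _ x y abs.
split=> //; first exact: bipolar_vertices.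
apply: finite_rational_vertices.
have [|v Vv _] := below 0 0; last by exists v.
by apply/polar_conv_hull => l; rewrite pairing0r lerN10.
Qed.

(** Without an active constraint a vertex is rigid in all directions, so the ambient
    space is zero.  This degenerate case has to be kept, for then the only
    vertex is [0]. *)
Lemma vertex_active (R : realType) (n : nat) (P : set 'rV[R]_n) (y : 'rV[R]_n) :
  rational_polytope P -> vertices (polar P) y ->
  (exists2 x, P x & pairing x y = -1) \/ forall d : 'rV[R]_n, d = 0.
Proof.
move=> [k [w ->]] Vy; have [act|none] := pselect (exists x,
    conv_hull (fun l => map_mx (@ratr R) (w l)) x /\ pairing x y = -1).
  by left; case: act => x [wx xy]; exists x.
right=> d; apply: (vertex_rigid Vy) => l yl; case: none.
by eexists; split; last exact: yl; apply/conv_hull_support => u; exists l.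
Qed.

(** * Dual parts of a labelled Minkowski decomposition *)

(** What is used of a generalized nef partition, with [v] an enumeration of the
    vertices of the polar, possibly with repetitions, and [p l] the part that
    contains [v l].  The notion serves twice, for [D] and for its dual parts,
    where it is available before the dual parts are known to be cut out by the
    vertices. *)
Record nef_labelling (R : realType) (n s k : nat) (D : 'I_s -> set 'rV[R]_n)
    (v : 'I_k -> 'rV[R]_n) (p : 'I_k -> 'I_s) : Prop := NefLabelling {
  labelling_hull :
    exists (m : nat) (w : 'I_m -> 'rV[R]_n), minkowski_sum D = conv_hull w;
  labelling_polar : polar (range v) `<=` minkowski_sum D;
  labelling_ge : forall i x l, D i x -> - (p l == i)%:R <= pairing x (v l)
}.

Lemma sum_delta (R : realType) (s : nat) (j : 'I_s) :
  \sum_(i < s) (j == i)%:R = 1 :> R.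
Proof.
by rewrite (bigD1 j)//= eqxx big1 ?addr0// => i /negbTE; rewrite eq_sym => ->.
Qed.

Lemma sum_label (R : realType) (s k : nat) (p : 'I_k -> 'I_s) (i : 'I_s)
    (a : 'I_k -> R) :
  \sum_l a l * - (p l == i)%:R = - \sum_(l | p l == i) a l.
Proof.
rewrite -sumrN [RHS]big_mkcond/=; apply: eq_bigr => l _.
by case: (p l == i); rewrite ?mulrN1 // oppr0 mulr0.
Qed.

Lemma labelling_ge_sum (R : realType) (n s k : nat) (D : 'I_s -> set 'rV[R]_n)
    (v : 'I_k -> 'rV[R]_n) (p : 'I_k -> 'I_s) (a : 'I_k -> R) (i : 'I_s)
    (x : 'rV[R]_n) :
  nef_labelling D v p -> (forall l, 0 <= a l) -> D i x ->
  - (\sum_(l | p l == i) a l) <= pairing x (\sum_l a l *: v l).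
Proof.
move=> L a0 Dx; rewrite pairing_sumr -sum_label; apply: ler_sum => l _.
by rewrite pairingZr ler_wpM2l// (labelling_ge L).
Qed.

(** Complementary slackness, refined to the summands: the coefficients are supported on
    the [v l] that take the value [-1] at a minimiser of [<., y>], and the
    components of this minimiser attain all their bounds there. *)
Lemma labelling_decomposition (R : realType) (n s k : nat)
    (D : 'I_s -> set 'rV[R]_n) (v : 'I_k -> 'rV[R]_n) (p : 'I_k -> 'I_s)
    (y : 'rV[R]_n) :
  nef_labelling D v p ->
  exists a : 'I_k -> R, [/\ forall l, 0 <= a l, y = \sum_l a l *: v l &
    forall i, exists2 x, D i x & pairing x y = - \sum_(l | p l == i) a l].
Proof.
move=> L; have [m [w Dw]] := labelling_hull L.
have polarw : polar (range v) `<=` conv_hull w.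
  by rewrite -Dw; exact: labelling_polar L.
have /conv_hull_support/(_ 0)[l0 _] : conv_hull w 0.
  apply: polarw => _ [l _ <-].
  by rewrite pairing0r lerN10.
case: (@arg_minP _ _ _ l0 xpredT (fun l => pairing y (w l))) => // l1 _ miny.
have [f [Df w1]] : minkowski_sum D (w l1).
  by rewrite Dw; apply/conv_hull_support => u; exists l1.
have w1v l : pairing (w l1) (v l) + 1 =
    \sum_i (pairing (f i) (v l) + (p l == i)%:R).
  by rewrite big_split/= sum_delta w1 pairing_suml.
have fv_ge0 l i : true -> 0 <= pairing (f i) (v l) + (p l == i)%:R.
  by move=> _; rewrite -lerBlDr sub0r (labelling_ge L).
have w1v_ge0 l : 0 <= pairing (w l1) (v l) + 1.
  by rewrite w1v; apply: sumr_ge0 => i; apply: fv_ge0.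
(* Inactive generators are replaced by [0] to stay with the same index type. *)
pose act l := pairing (w l1) (v l) + 1 == 0.
have [[a a0 yE]|[u uv uy]] := farkas (fun l => if act l then v l else 0) y.
  pose b l := if act l then a l else 0.
  have yb : y = \sum_l b l *: v l.
    rewrite yE; apply: eq_bigr => l _; rewrite /b; case: (act l) => //.
    by rewrite scale0r scaler0.
  exists b; split=> // [l|i]; first by rewrite /b; case: ifP.
  exists (f i) => //; rewrite yb pairing_sumr -sum_label; apply: eq_bigr => l _.
  rewrite pairingZr /b; case: ifPn => [|_]; last by rewrite !mul0r.
  rewrite /act w1v => /eqP/(psumr_eq0P (fv_ge0 l))/(_ i isT)/eqP.
  by rewrite addr_eq0 => /eqP ->.
have [e e0 He] := small_step (fun l => pairing (w l1) (v l) + 1)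
  (fun l => pairing u (v l)).
have : conv_hull w (w l1 + e *: u).
  apply: polarw => _ [l _ <-]; rewrite -subr_ge0 opprK pairingC.
  rewrite pairingDl pairingZl addrAC; have := uv l; rewrite /act.
  case: ifPn => [/eqP -> ?|w1l _]; first by rewrite add0r mulr_ge0// ltW.
  have w1l0 : 0 < pairing (w l1) (v l) + 1 by rewrite lt_neqAle eq_sym w1l w1v_ge0.
  rewrite -lerBlDr sub0r; apply: le_trans (He l w1l0).
  by rewrite -mulrN ler_wpM2l ?(ltW e0)// -normrN ler_norm.
move=> /conv_hull_support/(_ y)[l]; rewrite pairingDr pairingZr => yl.
have := le_trans (miny l isT) yl; rewrite lerDl pmulr_rge0// pairingC.
by move=> uy0; have := lt_le_trans uy uy0; rewrite ltxx.
Qed.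

Lemma labelling_dual (R : realType) (n s k : nat) (D : 'I_s -> set 'rV[R]_n)
    (v : 'I_k -> 'rV[R]_n) (p : 'I_k -> 'I_s) (l : 'I_k) :
  nef_labelling D v p -> dual_part D (p l) (v l).
Proof. by move=> L i x Dx; rewrite eq_sym; apply: labelling_ge L _ _ _ Dx. Qed.

(** The components [x] of the minimiser in the parts [D i] test [y]: the one in [D j]
    bounds the coefficients labelled [j] by 1 in total, the others kill the
    coefficients with another label.  So [y] lies in the convex hull of [0] and
    the [v l] labelled [j]. *)
Lemma dual_part_decomposition (R : realType) (n s k : nat)
    (D : 'I_s -> set 'rV[R]_n) (v : 'I_k -> 'rV[R]_n) (p : 'I_k -> 'I_s)
    (j : 'I_s) (y : 'rV[R]_n) :
  nef_labelling D v p -> dual_part D j y ->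
  exists a : 'I_k -> R, [/\ forall l, 0 <= a l,
    forall l, p l != j -> a l = 0, \sum_l a l <= 1 & y = \sum_l a l *: v l].
Proof.
move=> L dy; have [a [a0 yE xy]] := labelling_decomposition y L.
have Aj i : \sum_(l | p l == i) a l <= (i == j)%:R.
  by have [x Dx xyi] := xy i; rewrite -lerN2 -xyi dy.
have a_off l : p l != j -> a l = 0.
  move=> /negbTE pl; have A0 : \sum_(l' | p l' == p l) a l' = 0.
    by apply/eqP; rewrite eq_le sumr_ge0// andbT (le_trans (Aj _))// pl.
  by have /psumr_eq0P -> := A0.
exists a; split=> //; apply: le_trans (_ : \sum_(l | p l == j) a l <= _).
  rewrite [leRHS]big_mkcond; apply: ler_sum => l _ /=.
  by case: ifPn => // /a_off ->.
by have := Aj j; rewrite eqxx.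
Qed.

Lemma dual_sum_ge (R : realType) (n s : nat) (D : 'I_s -> set 'rV[R]_n)
    (y x : 'rV[R]_n) (i : 'I_s) :
  minkowski_sum (dual_part D) y -> D i x -> -1 <= pairing x y.
Proof.
move=> [f [Df ->]] Dx; rewrite -(sum_delta R i) -sumrN pairing_sumr.
by apply: ler_sum => j _; apply: Df.
Qed.

(** Grouping the terms of the decomposition of [y] by label gives its components in
    the dual parts. *)
Lemma dual_sum_mem (R : realType) (n s k : nat) (D : 'I_s -> set 'rV[R]_n)
    (v : 'I_k -> 'rV[R]_n) (p : 'I_k -> 'I_s) (y : 'rV[R]_n) :
  nef_labelling D v p -> (forall i x, D i x -> -1 <= pairing x y) ->
  minkowski_sum (dual_part D) y.
Proof.
move=> L y_ge; have [a [a0 yE xy]] := labelling_decomposition y L.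
exists (fun j => \sum_(l | p l == j) a l *: v l); split=> [j i x Dx|]; last first.
  by rewrite yE (partition_big p xpredT).
pose b l := if p l == j then a l else 0.
have -> : \sum_(l | p l == j) a l *: v l = \sum_l b l *: v l.
  rewrite big_mkcond; apply: eq_bigr => l _; rewrite /b.
  by case: ifP => // _; rewrite scale0r.
apply: le_trans (labelling_ge_sum (a := b) L _ Dx); last first.
  by move=> l; rewrite /b; case: ifP.
rewrite lerN2; have [->|ij] := eqVneq i j; last first.
  by rewrite big1// => l /eqP pl; rewrite /b pl (negbTE ij).
rewrite [leLHS](_ : _ = \sum_(l | p l == j) a l); last first.
  by apply: eq_bigr => l; rewrite /b => ->.
by have [z Dz zy] := xy j; rewrite -lerN2 -zy; apply: y_ge Dz.
Qed.

Lemma part_sub_polar_dual_sum (R : realType) (n s : nat)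
    (D : 'I_s -> set 'rV[R]_n) (i : 'I_s) :
  D i `<=` polar (minkowski_sum (dual_part D)).
Proof. by move=> x Dx y dy; rewrite pairingC; apply: dual_sum_ge dy Dx. Qed.

(** The sum of the hulls of [0] and the [v l] labelled [j] is the hull of the sums
    obtained by choosing one generator for each [j]; [None] stands for the
    generator [0].  The support criterion avoids product weights: each form
    is minimised summand by summand. *)
Lemma rational_dual_sum (R : realType) (n s k : nat) (D : 'I_s -> set 'rV[R]_n)
    (v : 'I_k -> 'rV[rat]_n) (p : 'I_k -> 'I_s) :
  nef_labelling D (fun l => map_mx (@ratr R) (v l)) p ->
  rational_polytope (minkowski_sum (dual_part D)).
Proof.
move=> L; pose T := {ffun 'I_s -> option 'I_k}.
pose g j o := if o is Some l then if p l == j then v l else 0 else 0.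
pose gR j o := map_mx (@ratr R) (g j o).
pose t (f : T) := \sum_j g j (f j).
have tE f : map_mx (@ratr R) (t f) = \sum_j gR j (f j) by rewrite raddf_sum.
have gR0 : map_mx (@ratr R) 0 = 0 :> 'rV_n by rewrite map_mx0.
have g_dual j o : dual_part D j (gR j o).
  rewrite /gR; case: o => [l|] /=; last first.
    by move=> i x _; rewrite gR0 pairing0r oppr_le0.
  case: eqP => [<-|_]; first exact: (labelling_dual l L).
  by move=> i x _; rewrite gR0 pairing0r oppr_le0.
exists #|T|, (fun i => t (enum_val i)); apply/seteqP; split=> y.
  move=> [f [df ->]]; apply/conv_hull_support => u.
  have /choice[F HF] j : exists o, pairing u (gR j o) <= pairing u (f j).
    have [a [a0 a_off a1 fE]] := dual_part_decomposition L (df j).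
    apply: contrapT => /forallNP ltg.
    pose c := pairing u (f j).
    have gt_c o : 0 < pairing u (gR j o) - c.
      by rewrite subr_gt0 ltNge; apply/negP/ltg.
    have c0 : c < 0 by have := gt_c None; rewrite /gR gR0 pairing0r sub0r oppr_gt0.
    have cE : c = \sum_l a l * pairing u (gR j (Some l)).
      rewrite /c {1}fE pairing_sumr; apply: eq_bigr => l _; rewrite pairingZr.
      by rewrite /gR /g; case: ifPn => // /a_off ->; rewrite !mul0r.
    have term_ge0 l : true -> 0 <= a l * (pairing u (gR j (Some l)) - c).
      by move=> _; rewrite mulr_ge0 // ltW.
    have sum_le0 : \sum_l a l * (pairing u (gR j (Some l)) - c) <= 0.
      under eq_bigr => l _ do rewrite mulrBr.
      rewrite sumrB -cE -mulr_suml subr_le0 -[leLHS]mul1r.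
      by rewrite ler_nM2r.
    have /(psumr_eq0P term_ge0) a_eq0 :
        \sum_l a l * (pairing u (gR j (Some l)) - c) = 0.
      by apply/eqP; rewrite eq_le sum_le0 sumr_ge0.
    have := c0; rewrite cE big1 ?ltxx// => l _.
    have /eqP := a_eq0 l isT; rewrite mulf_eq0 (gt_eqF (gt_c _)) orbF => /eqP ->.
    by rewrite mul0r.
  exists (enum_rank ([ffun j => F j] : T)); rewrite enum_rankK tE !pairing_sumr.
  by apply: ler_sum => j _; rewrite ffunE.
move=> /conv_hull_support hy; apply: (dual_sum_mem L) => i x Dx.
have [l] := hy x; apply: le_trans; rewrite tE; apply: dual_sum_ge Dx.
by exists (fun j => gR j (enum_val l j)).
Qed.

(** The vertex is the minimiser of its exposing form [u] on the part [D i] for which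
    the sum of the coefficients of [u] labelled [i] is largest. *)
Lemma dual_vertex_mem (R : realType) (n s k : nat) (D : 'I_s -> set 'rV[R]_n)
    (v : 'I_k -> 'rV[R]_n) (p : 'I_k -> 'I_s) (i0 : 'I_s) (w : 'rV[R]_n) :
  nef_labelling D v p ->
  vertices (polar (minkowski_sum (dual_part D))) w -> exists i, D i w.
Proof.
move=> L [Qw [u uw]]; have [a [a0 uE xu]] := labelling_decomposition u L.
pose A i := \sum_(l | p l == i) a l.
case: (@arg_maxP _ _ _ i0 xpredT A) => // i _ maxA.
have A0 : 0 <= A i by rewrite sumr_ge0.
have [x Dx xui] := xu i; exists i; have [<-//|/eqP xw] := eqVneq x w.
have := uw x (part_sub_polar_dual_sum Dx) xw; rewrite (pairingC u x) xui -/(A i).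
(* Dividing [u] by some [c] strictly between [A i] and [- pairing u w], and not by
   [A i] itself, leaves no separate case [A i = 0]. *)
move=> uwA; exfalso; pose c := (A i - pairing u w) / 2.
have [c0 cA cw] : [/\ 0 < c, A i <= c & c < - pairing u w].
  by rewrite /c; split; lra.
have : -1 <= pairing (c^-1 *: u) w.
  apply: Qw; apply: (dual_sum_mem L) => j z Dz.
  rewrite pairingZr mulrC ler_pdivlMr// mulN1r {1}uE.
  apply: le_trans (labelling_ge_sum L a0 Dz); rewrite lerN2.
  exact: le_trans (maxA j isT) cA.
rewrite pairingZl mulrC ler_pdivlMr// mulN1r; lra.
Qed.

(** A point of two parts is nonnegative on all [v l], hence zero; and zero is a vertex
    of the polar only if that polar, which contains the parts, is reduced to it. *)
Lemma dual_vertex_meet (R : realType) (n s k : nat) (D : 'I_s -> set 'rV[R]_n)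
    (v : 'I_k -> 'rV[R]_n) (p : 'I_k -> 'I_s) (i j : 'I_s) (w : 'rV[R]_n) :
  nef_labelling D v p ->
  (forall u, exists2 e : R, 0 < e & minkowski_sum D (e *: u)) ->
  vertices (polar (minkowski_sum (dual_part D))) w ->
  D i w -> D j w -> i != j -> forall u : 'rV[R]_n, u = 0.
Proof.
move=> L abs [_ [u uw]] Diw Djw ij.
have w0 : w = 0.
  apply/eqP; apply: contraT => /pairing_gt0; rewrite ltNge -oppr_ge0 -pairingNr.
  have [a [a0 -> _]] := labelling_decomposition (- w) L.
  rewrite pairing_sumr sumr_ge0// => l _; rewrite pairingZr mulr_ge0//.
  have := labelling_ge L l Diw; have := labelling_ge L l Djw.
  by case: eqP => [->|_]; rewrite ?oppr0// (eq_sym j) (negbTE ij) oppr0.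
subst w; have [a [a0 uE xu]] := labelling_decomposition u L.
have A0 i' : \sum_(l | p l == i') a l = 0.
  have [x Dx xui] := xu i'; apply/eqP; rewrite -oppr_eq0 -xui.
  have [->|/eqP x0] := eqVneq x 0; first by rewrite pairing0l.
  have := uw x (part_sub_polar_dual_sum Dx) x0.
  by rewrite pairing0r pairingC xui ltNge oppr_le0 sumr_ge0.
have u0 : u = 0.
  rewrite uE big1// => l _; rewrite (_ : a l = 0) ?scale0r//.
  by have /psumr_eq0P -> := A0 (p l).
have D0 i' x : D i' x -> x = 0.
  move=> Dx; apply/eqP; apply: contraT => /eqP x0.
  have := uw x (part_sub_polar_dual_sum Dx) x0.
  by rewrite u0 !pairing0l ltxx.
move=> z; have [e e0 [f [Df ezf]]] := abs z.
have /eqP : e *: z = 0 by rewrite ezf big1// => i' _; apply: D0 (Df i').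
by rewrite scaler_eq0 (gt_eqF e0) => /eqP.
Qed.

Lemma partition_label (R : realType) (n s k : nat) (v : 'I_k -> 'rV[R]_n)
    (I : 'I_s -> set 'rV[R]_n) :
  partition setT I (range v) ->
  exists p : 'I_k -> 'I_s, forall l i, (v l \in I i) = (p l == i).
Proof.
move=> [coverI trivI _].
have /choice[p Hp] l : exists i, I i (v l).
  by have : range v (v l) by []; rewrite -coverI => -[i _ Iv]; exists i.
exists p => l i; apply/idP/eqP => [|<-]; last by rewrite inE.
by rewrite inE => Iv; apply: trivI => //; exists (v l).
Qed.

(** * Duality of generalized nef partitions *)

Theorem proposition2p9 (R : realType) (n s : nat) (Delta : set 'rV[R]_n)
    (D : 'I_s -> set 'rV[R]_n) (hD : generalized_nef_partition Delta D) :
  generalized_nef_partition (minkowski_sum (dual_part D)) (dual_part D) /\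
  (forall i : 'I_s,
     D i = [set x : 'rV[R]_n | forall (j : 'I_s) (y : 'rV[R]_n),
              dual_part D j y -> - (i == j)%:R <= pairing x y]).
Proof.
have [ratD intD [I [partI DE]] sumD] := hD.
have [bipolarD belowD [k [v0 VE]]] := rational_polytope_vertices ratD intD.
pose v l := map_mx (@ratr R) (v0 l).
rewrite VE in partI bipolarD.
have [p vI] : exists p : 'I_k -> 'I_s, forall l i, (v l \in I i) = (p l == i).
  exact: partition_label partI.
have vertex_v l : vertices (polar Delta) (v l) by rewrite VE; exists l.
have vD i x l : D i x -> - (p l == i)%:R <= pairing x (v l).
  rewrite DE => /(_ _ (vertex_v l)).
  by rewrite indicE vI.
have L : nef_labelling D v p.
  split=> //; last by rewrite -sumD bipolarD.
  by have [m [w wE]] := ratD; exists m, (fun l => map_mx (@ratr R) (w l)); rewrite -sumD.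
have DsubDelta i : D i `<=` Delta.
  move=> x Dx; rewrite -bipolarD => _ [l _ <-]; rewrite pairingC.
  by apply: le_trans (vD i x l Dx); rewrite lerN2; case: (p l == i).
split; last first.
  move=> i; apply/seteqP; split=> x /=; first by move=> Dx j y; apply.
  move=> xdual; rewrite DE => y; rewrite VE => -[l _ <-]; rewrite indicE vI eq_sym.
  exact: xdual _ _ (labelling_dual l L).
pose nabla := minkowski_sum (dual_part D).
have ratN : rational_polytope nabla := rational_dual_sum L.
have intN : interior nabla 0.
  have [m [w wE]] := ratD.
  apply: (@filterS _ (nbhs (0 : 'rV[R]_n)) _ (polar Delta)); last first.
    by rewrite wE; apply: interior_polar_conv_hull.
  move=> y Qy; apply: (dual_sum_mem L) => i x /DsubDelta; exact: Qy.
have [bipolarN belowN [k' [w0 WE]]] := rational_polytope_vertices ratN intN.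
pose w l := map_mx (@ratr R) (w0 l).
pose J i := vertices (polar nabla) `&` D i.
have Ip i : exists l, p l = i.
  have [coverI _ neI] := partI; have [y Iy] := neI i Logic.I.
  have : range v y by rewrite -coverI; exists i.
  by move=> [l _ ly]; exists l; apply/eqP; rewrite -vI; apply/mem_set; rewrite ly.
(* In dimension zero all the [v l] coincide, so there is only one part. *)
have trivial_s : (forall d : 'rV[R]_n, d = 0) -> forall i j : 'I_s, i = j.
  move=> d0 i j; have [[l <-] [l' <-]] := (Ip i, Ip j).
  by apply/eqP; rewrite -vI (_ : v l = v l') ?vI// (d0 (v l)) [RHS]d0.
have W_mem y : vertices (polar nabla) y -> exists i, D i y.
  have [|y0 Vy0 _] := belowD 0 0; first by move=> x _; rewrite pairing0r lerN10.
  move: Vy0; rewrite VE => -[l _ _]; exact: dual_vertex_mem (p l) _ L.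
have partJ : partition setT J (vertices (polar nabla)).
  split.
  - apply/seteqP; split=> [y [i _ []//]|y Wy].
    by have [i Diy] := W_mem y Wy; exists i.
  - move=> i j _ _ [y [[Wy Diy] [_ Djy]]].
    have [//|ij] := eqVneq i j; apply: trivial_s.
    apply: (dual_vertex_meet L _ Wy Diy Djy ij).
    by rewrite -sumD; apply: interior_absorbing.
  - move=> i _; have [l pl] := Ip i.
    have [[x Dx xv]|d0] := vertex_active ratD (vertex_v l); last first.
      have [|y Wy _] := belowN 0 0; first by move=> x _; rewrite pairing0r lerN10.
      have [j Djy] := W_mem y Wy; exists y; split=> //.
      by rewrite (trivial_s d0 i j).
    move: Dx; rewrite sumD => -[f [Df xf]].
    (* The other components of [x] are nonnegative on [v l]. *)
    have fv : pairing (f i) (v l) <= -1.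
      rewrite -xv xf pairing_suml (bigD1 i)//= lerDl sumr_ge0// => j /negbTE ji.
      have := vD j (f j) l (Df j); by rewrite pl eq_sym ji oppr0.
    have [y Wy] := belowN (v l) (f i) (part_sub_polar_dual_sum (Df i)).
    rewrite (pairingC _ (f i)) => yf; have [j Djy] := W_mem y Wy.
    exists y; split=> //; have := vD j y l Djy; rewrite pl pairingC.
    case: eqP => [->//|_] y0.
    by have := le_trans y0 (le_trans yf fv); rewrite oppr0 ler0N1.
have [q wJ] : exists q : 'I_k' -> 'I_s, forall l i, (w l \in J i) = (q l == i).
  by apply: partition_label; rewrite -WE.
have vertex_w l : vertices (polar nabla) (w l) by rewrite WE; exists l.
have wD l : D (q l) (w l).
  by have := wJ l (q l); rewrite eqxx => /set_mem[].
(* The roles are now exchanged: the labelled vectors are the vertices [w l]. *)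
have L' : nef_labelling (dual_part D) w q.
  split; last by move=> j y l; rewrite pairingC; apply; apply: wD.
    by have [m [t tE]] := ratN; exists m, (fun l => map_mx (@ratr R) (t l)).
  by rewrite -[X in X `<=` _]/(polar (range w)) -WE bipolarN.
split=> //; exists J; split=> // j.
apply/seteqP; split=> y /=.
  move=> dy x Wx; rewrite indicE pairingC.
  have [i Dix] := W_mem x Wx; apply: le_trans (dy i x Dix).
  have [ij|_] := eqVneq i j; last by rewrite oppr0 oppr_le0.
  by rewrite mem_set//; split=> //; rewrite -ij.
move=> yJ i x Dx.
have [b [b0 xE yb]] := labelling_decomposition x L'.
have yw l : - (q l == j)%:R <= pairing (w l) y.
  by have := yJ _ (vertex_w l); rewrite indicE wJ pairingC.
apply: (@le_trans _ _ (- \sum_(l | q l == j) b l)).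
  have [z dz <-] := yb j; rewrite pairingC; exact: dz i x Dx.
rewrite xE pairing_suml -sum_label; apply: ler_sum => l _.
by rewrite pairingZl ler_wpM2l.
Qed.
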